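(* Let $I=\langle p_1,\ldots,p_r\rangle\subset\mathbb{Q}[z_1,\ldots,z_n]$ be a radical zero-dimensional ideal such that $V(I)\cap\overline{\mathbb{U}}^n=\emptyset$, let $t=a_1z_1+\cdots+a_nz_n$, $f,g_{z_1},\ldots,g_{z_n}\in\mathbb{Q}[t]$ be a univariate representation of $V(I)$ with $f$ monic and squarefree, and let $I_r=\langle f(t),\,z_1-g_{z_1}(t),\ldots,z_n-g_{z_n}(t)\rangle\subset\mathbb{Q}[t,z_1,\ldots,z_n]$. For every sufficiently small $\epsilon>0$, let $\tilde f_\epsilon\in\mathbb{Q}[t]$, $\tilde s_\epsilon\in\mathbb{Q}[z_1,\ldots,z_n]$ and $\tilde h_{0,\epsilon}\in\mathbb{Q}[t]$ be the polynomials obtained by the construction at precision $\epsilon$ described in the context. Then the polynomial $$s=\tilde s_\epsilon-\tilde h_{0,\epsilon}\,(\tilde f_\epsilon-f)\in\mathbb{Q}[t,z_1,\ldots,z_n]$$ belongs to the ideal $I_r$. Moreover, there exists $\epsilon>0$ such that the polynomial $s\left(\sum_{i=1}^n a_iz_i,\,z_1,\ldots,z_n\right)\in\mathbb{Q}[z_1,\ldots,z_n]$, obtained from $s$ by substituting $t=\sum_{i=1}^n a_iz_i$, is a stable polynomial.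
   Context: Notation. $\overline{\mathbb{U}}^n=\{z\in\mathbb{C}^n\mid |z_1|\leq1,\ldots,|z_n|\leq1\}$ is the closed unit polydisc. For an ideal $I=\langle p_1,\ldots,p_r\rangle\subset\mathbb{Q}[z_1,\ldots,z_n]$, $V(I)=\{z\in\mathbb{C}^n\mid p_1(z)=\cdots=p_r(z)=0\}$; $I$ is zero-dimensional if $V(I)$ is finite. A polynomial $p\in\mathbb{Q}[z_1,\ldots,z_n]$ is stable if it has no zeros in $\overline{\mathbb{U}}^n$. Univariate representation of $V(I)$: a linear form $t=a_1z_1+\cdots+a_nz_n$ with $a_i\in\mathbb{Q}$ together with polynomials $f,g_{z_1},\ldots,g_{z_n}\in\mathbb{Q}[t]$ such that the maps $V(I)\to V(f)=\{\zeta\in\mathbb{C}\mid f(\zeta)=0\}$, $(z_1,\ldots,z_n)\mapsto\sum_i a_iz_i$, and $V(f)\to V(I)$, $\zeta\mapsto(g_{z_1}(\zeta),\ldots,g_{z_n}(\zeta))$, are mutually inverse bijections. Since $I$ is radical, $f$ is squarefree; write $f(t)=\prod_{i=1}^d(t-\gamma_i)$ with distinct $\gamma_1,\ldots,\gamma_d\in\mathbb{C}$. Boxes. For $u,v\in\mathbb{C}$ with $\Re(u)<\Re(v)$, $\Im(u)<\Im(v)$, the box $B(u,v)$ is the open rectangle $\{\zeta\in\mathbb{C}\mid\Re(u)<\Re(\zeta)<\Re(v),\ \Im(u)<\Im(\zeta)<\Im(v)\}$, of width $w(B)=\max\{|\Re(v-u)|,|\Im(v-u)|\}$; it has rational endpoints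 if $\Re(u),\Im(u),\Re(v),\Im(v)\in\mathbb{Q}$. For $g\in\mathbb{Q}[t]$, $\mathcal{C}(g)=\Re(g)^2+\Im(g)^2-1\in\mathbb{Q}[x_1,x_2]$, where $\Re(g),\Im(g)$ are the real and imaginary parts of $g(x_1+i\,x_2)$. For $h\in\mathbb{Q}[x_1,x_2]$ and $B=B(u,v)$, $\square h(B)$ is the interval obtained by evaluating $h$ (written in a fixed way, e.g. in expanded form as a sum of monomials) in exact interval arithmetic with $x_1\in[\Re(u),\Re(v)]$, $x_2\in[\Im(u),\Im(v)]$. $\mathbb{R}_+$ denotes the set of positive real numbers. Construction at precision $\epsilon$. 1. Choose pairwise disjoint boxes $B_1,\ldots,B_d$ with rational endpoints such that $B_i$ contains $\gamma_i$ and no other root of $f$, $w(B_i)\leq\epsilon$, and each $B_i$ is small enough that there is an index $k_i\in\{1,\ldots,n\}$ with $\square\,\mathcal{C}(g_{z_{k_i}})(B_i)\subset\mathbb{R}_+$ (this is possible since $V(I)\cap\overline{\mathbb{U}}^n=\emptyset$); fix such an index $k_i$ for each $i$. 2. Let $\tilde\gamma_{i,\epsilon}$ be the midpoint of $B_i$, and set $\tilde f_\epsilon(t)=\prod_{i=1}^d(t-\tilde\gamma_{i,\epsilon})$ and $\tilde s_\epsilon(z_1,\ldots,z_n)=\prod_{i=1}^d\left(z_{k_i}-g_{z_{k_i}}(\tilde\gamma_{i,\epsilon})\right)$. 3. Let $\tilde h_{0,\epsilon}(t)$ be the quotient of the Euclidean division of $\tilde s_\epsilon(g_{z_1}(t),\ldots,g_{z_n}(t))$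 by $\tilde f_\epsilon(t)$. The boxes and indices are chosen so that $\tilde f_\epsilon$ and $\tilde s_\epsilon$ have rational coefficients (for instance, boxes of complex conjugate roots are complex conjugate, and the same index is used for conjugate roots). *)

(* Defs.v *)
(* The complex field is R[i] for R : realType. *)
From mathcomp Require Import all_boot all_order all_algebra.
From mathcomp Require Import classical_sets cardinality reals complex.
From mathcomp Require Import mpoly.

Set Implicit Arguments.
Unset Strict Implicit.
Unset Printing Implicit Defensive.

Import Order.TTheory GRing.Theory Num.Theory.
Local Open Scope ring_scope.
Local Open Scope complex_scope.
Local Open Scope classical_set_scope.

(* Num.Theory shadows the projections of R[i] by operations R[i] -> R[i]. *)
Local Notation Re := complex.Re.
Local Notation Im := complex.Im.

Definition in_ideal (A : comNzRingType) (J : finType) (gen : J -> A) (q : A) :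
  Prop := exists c : J -> A, q = \sum_j c j * gen j.

Definition radical_ideal (A : comNzRingType) (J : finType) (gen : J -> A) :
  Prop := forall (q : A) (m : nat), in_ideal gen (q ^+ m) -> in_ideal gen q.

Definition squarefree_poly (f : {poly rat}) : Prop :=
  forall u : {poly rat}, size u != 1%N -> ~~ (u ^+ 2 %| f).

Definition pevalC (R : realType) (f : {poly rat}) (x : R[i]) : R[i] :=
  (map_poly ratr f).[x].

Definition mevalC (R : realType) (n : nat) (p : {mpoly rat[n]})
  (z : 'I_n -> R[i]) : R[i] := (map_mpoly ratr p).@[z].

Definition zero_locus (R : realType) (n r : nat) (p : 'I_r -> {mpoly rat[n]}) :
  set ('I_n -> R[i]) := [set z | forall j, mevalC (p j) z = 0].

Definition closed_polydisc (R : realType) (n : nat) : set ('I_n -> R[i]) :=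
  [set z | forall i, `|z i| <= 1].

Definition stable (R : realType) (n : nat) (p : {mpoly rat[n]}) : Prop :=
  forall z : 'I_n -> R[i], @closed_polydisc R n z -> mevalC p z != 0.

Definition linear_form (R : realType) (n : nat) (a : 'I_n -> rat)
  (z : 'I_n -> R[i]) : R[i] := \sum_i ratr (a i) * z i.

Definition gpoint (R : realType) (n : nat) (g : 'I_n -> {poly rat})
  (x : R[i]) : 'I_n -> R[i] := fun i => pevalC (g i) x.

Definition univariate_representation (R : realType) (n r : nat)
    (p : 'I_r -> {mpoly rat[n]}) (a : 'I_n -> rat) (f : {poly rat})
    (g : 'I_n -> {poly rat}) : Prop :=
  [/\ forall z : 'I_n -> R[i],
        zero_locus p z -> pevalC f (linear_form a z) = 0,
      forall x : R[i], pevalC f x = 0 -> zero_locus p (gpoint g x),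
      forall z : 'I_n -> R[i],
        zero_locus p z -> forall i, gpoint g (linear_form a z) i = z i &
      forall x : R[i], pevalC f x = 0 -> linear_form a (gpoint g x) = x].

Definition box (R : realType) (u v : R[i]) : set R[i] :=
  [set x | Re u < Re x < Re v /\ Im u < Im x < Im v].

Definition width (R : realType) (u v : R[i]) : R :=
  Num.max `|Re (v - u)| `|Im (v - u)|.

Definition rational_point (R : realType) (u : R[i]) : Prop :=
  exists x y : rat, u = ratr x +i* ratr y.

Definition midpoint (R : realType) (u v : R[i]) : R[i] := (u + v) / 2%:R.

Definition X1 : {mpoly rat[2]} := 'X_ord0.
Definition X2 : {mpoly rat[2]} := 'X_ord_max.

(* Real and imaginary parts of (x1 + i x2)^k. *)
Fixpoint reim_pow (k : nat) : {mpoly rat[2]} * {mpoly rat[2]} :=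
  if k is k'.+1 then
    let: (b, c) := reim_pow k' in (X1 * b - X2 * c, X1 * c + X2 * b)
  else (1, 0).

Definition re_poly (g : {poly rat}) : {mpoly rat[2]} :=
  \sum_(k < size g) g`_k *: (reim_pow k).1.

Definition im_poly (g : {poly rat}) : {mpoly rat[2]} :=
  \sum_(k < size g) g`_k *: (reim_pow k).2.

Definition Cpoly (g : {poly rat}) : {mpoly rat[2]} :=
  re_poly g ^+ 2 + im_poly g ^+ 2 - 1.

(* Ways of writing a polynomial of Q[x1, x2]: interval evaluation depends on
   the expression, not only on the polynomial that it denotes. *)
Inductive iexpr : Type :=
| ICst of rat
| IX1
| IX2
| IOpp of iexpr
| IAdd of iexpr & iexpr
| IMul of iexpr & iexpr
| IPow of iexpr & nat.

Fixpoint iexpr_poly (e : iexpr) : {mpoly rat[2]} :=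
  match e with
  | ICst c => c%:MP
  | IX1 => X1
  | IX2 => X2
  | IOpp e1 => - iexpr_poly e1
  | IAdd e1 e2 => iexpr_poly e1 + iexpr_poly e2
  | IMul e1 e2 => iexpr_poly e1 * iexpr_poly e2
  | IPow e1 k => iexpr_poly e1 ^+ k
  end.

(* Exact interval arithmetic: each operation returns the exact range of the
   operation on its operands, taken as independent. *)
Fixpoint ieval (R : realType) (I J : set R) (e : iexpr) : set R :=
  match e with
  | ICst c => [set ratr c]
  | IX1 => I
  | IX2 => J
  | IOpp e1 => [set - x | x in ieval I J e1]
  | IAdd e1 e2 => [set x + y | x in ieval I J e1 & y in ieval I J e2]
  | IMul e1 e2 => [set x * y | x in ieval I J e1 & y in ieval I J e2]
  | IPow e1 k => [set x ^+ k | x in ieval I J e1]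
  end.

Definition ieval_box (R : realType) (e : iexpr) (u v : R[i]) : set R :=
  ieval [set x | Re u <= x <= Re v] [set x | Im u <= x <= Im v] e.

Definition expanded (h : {mpoly rat[2]}) : iexpr :=
  foldr (fun m e => IAdd (IMul (ICst h@_m)
           (IMul (IPow IX1 (m ord0)) (IPow IX2 (m ord_max)))) e)
        (ICst 0) (msupp h).

(* Q[t, z_1, ..., z_n] is {mpoly rat[n.+1]} with t = 'X_ord0 and
   z_i = 'X_(lift ord0 i). *)
Definition emb_t (n : nat) (q : {poly rat}) : {mpoly rat[n.+1]} :=
  (map_poly (@mpolyC n.+1 rat) q).['X_ord0].

Definition emb_z (n : nat) (q : {mpoly rat[n]}) : {mpoly rat[n.+1]} :=
  q \mPo [tuple 'X_(lift ord0 i) | i < n].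

Definition subst_t (n : nat) (a : 'I_n -> rat) (s : {mpoly rat[n.+1]}) :
  {mpoly rat[n]} :=
  s \mPo [tuple (if unlift ord0 j is Some i then 'X_i
                 else \sum_i a i *: 'X_i) | j < n.+1].

Definition Ir_gen (n : nat) (f : {poly rat}) (g : 'I_n -> {poly rat})
  (j : option 'I_n) : {mpoly rat[n.+1]} :=
  if j is Some i then 'X_(lift ord0 i) - emb_t n (g i) else emb_t n f.

(* A possible outcome, at precision eps, of the choices of the boxes
   B_i = box (lo i) (hi i) and of the indices idx i; wr fixes how polynomials
   are written for interval evaluation.  The fields ftildeE and stildeE also
   express that ftilde and stilde have rational coefficients. *)
Record construction (R : realType) (n d : nat) (wr : {mpoly rat[2]} -> iexpr)
    (f : {poly rat}) (g : 'I_n -> {poly rat}) (gamma : 'I_d -> R[i])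
    (eps : R) : Type := Construction {
  lo : 'I_d -> R[i];
  hi : 'I_d -> R[i];
  idx : 'I_d -> 'I_n;
  ftilde : {poly rat};
  stilde : {mpoly rat[n]};
  box_valid : forall i, Re (lo i) < Re (hi i) /\ Im (lo i) < Im (hi i);
  box_rational : forall i, rational_point (lo i) /\ rational_point (hi i);
  box_disjoint : forall i j, i != j ->
    box (lo i) (hi i) `&` box (lo j) (hi j) = set0;
  box_root : forall i, box (lo i) (hi i) (gamma i);
  box_isolating : forall i x,
    box (lo i) (hi i) x -> pevalC f x = 0 -> x = gamma i;
  box_width : forall i, width (lo i) (hi i) <= eps;
  box_positive : forall i,
    ieval_box (wr (Cpoly (g (idx i)))) (lo i) (hi i) `<=` [set x | 0 < x];
  ftildeE : map_poly ratr ftilde =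
    \prod_i ('X - (midpoint (lo i) (hi i))%:P);
  stildeE : map_mpoly ratr stilde =
    \prod_i ('X_(idx i) - (gpoint g (midpoint (lo i) (hi i)) (idx i))%:MP)
}.

Section Output.
Context (R : realType) (n d : nat) (wr : {mpoly rat[2]} -> iexpr).
Context (f : {poly rat}) (g : 'I_n -> {poly rat}) (gamma : 'I_d -> R[i]).
Context (eps : R) (D : construction wr f g gamma eps).

(* mmap polyC g p is p(g_1(t), ..., g_n(t)). *)
Definition htilde : {poly rat} := mmap polyC g (stilde D) %/ ftilde D.

Definition s_poly : {mpoly rat[n.+1]} :=
  emb_z (stilde D) - emb_t n htilde * (emb_t n (ftilde D) - emb_t n f).

End Output.

Lemma expandedK (h : {mpoly rat[2]}) : iexpr_poly (expanded h) = h.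
Proof.
rewrite {2}[h]mpolyE /expanded; elim: (msupp h) => [|m s IHs].
  by rewrite big_nil /= mpolyC0.
rewrite big_cons /= IHs mul_mpolyC [in RHS]mpolyXE_id.
rewrite big_ord_recl big_ord1 /X1 /X2.
by have -> : lift ord0 ord0 = ord_max :> 'I_2 by apply: val_inj.
Qed.

Lemma reim_powE (R : realType) (w : 'I_2 -> R) (k : nat) :
  (w ord0 +i* w ord_max) ^+ k = (map_mpoly ratr (reim_pow k).1).@[w]
                                +i* (map_mpoly ratr (reim_pow k).2).@[w].
Proof.
elim: k => [|k IHk]; first by rewrite /= !(mpolyC1, mpolyC0, rmorph1, rmorph0) expr0.
rewrite exprS IHk /=; case: (reim_pow k) => b c /=.
rewrite !(rmorphB, rmorphD, rmorphM) /= /X1 /X2 !map_mpolyX !mevalX.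
have E i : \prod_(j < 2) w j ^+ U_(i)%MM j = w i.
  rewrite (bigD1 i) //= mnm1E eqxx expr1 big1 ?mulr1 // => j jDi.
  by rewrite mnm1E eq_sym (negPf jDi) expr0.
by rewrite ?E; simpc.
Qed.

Lemma re_im_polyE (R : realType) (g : {poly rat}) (w : 'I_2 -> R) :
  pevalC g (w ord0 +i* w ord_max) = (map_mpoly ratr (re_poly g)).@[w]
                                    +i* (map_mpoly ratr (im_poly g)).@[w].
Proof.
rewrite /pevalC /re_poly /im_poly horner_coef size_map_poly.
rewrite 2!(raddf_sum (map_mpoly ratr)) !(raddf_sum (meval w)) /=.
elim/big_rec3: _ => [|i x y z _ ->]; first by [].
rewrite !map_mpolyZ !mevalZ coef_map /= reim_powE.
have -> : ratr g`_i = (ratr g`_i)%:C :> R[i].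
  by rewrite -(fmorph_eq_rat (real_complex R \o ratr)).
by simpc.
Qed.

(* Main.v *)
Require Import Defs.
From mathcomp Require Import all_boot all_order all_algebra.
From mathcomp Require Import classical_sets cardinality reals complex.
From mathcomp Require Import mpoly ring lra.

Set Implicit Arguments.
Unset Strict Implicit.
Unset Printing Implicit Defensive.

Import Order.TTheory GRing.Theory Num.Theory.
Local Open Scope ring_scope.
Local Open Scope complex_scope.
Local Open Scope classical_set_scope.

Local Notation Re := complex.Re.
Local Notation Im := complex.Im.

(** Write m_i for the midpoint of the i-th box and k_i for its index.

    Membership.  Modulo I_r one may replace z_i by g_i(t) and f by 0, so that
    s becomes st(g(t)) - h ft, where st, ft, h stand for the outputs of the
    construction; this is the remainder in the division that defines h.  That
    remainder vanishes, whatever the precision: over C, st(g(t)) is the product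
    of the g_{k_i}(t) - g_{k_i}(m_i), and t - m_i divides the i-th factor
    ([mmap_stilde], [htildeK], [emb_z_eq_emb_t]).

    Stability.  Let z be in the closed polydisc and t = sum a_i z_i, so that
    s(t, z) = st(z) - h(t) (ft(t) - f(t)) with t bounded independently of z.
    - h is the product of the difference quotients of g_{k_i} at m_i, hence
      h(t) is bounded independently of the boxes, as long as eps <= 1
      ([htildeE], [bounded_difference_quotient]).
    - ft(t) - f(t) = prod (t - m_i) - prod (t - gamma_i) is O(eps)
      ([ler_dist_prod]).
    - Interval positivity forces |g_{k_i}(gamma_i)| > 1 ([idx_gt1]).  Only
      finitely many pairs (i, k) occur, so these moduli exceed 1 by a fixed
      amount, and for small eps so do the |g_{k_i}(m_i)|.  As |z_{k_i}| <= 1,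
      this bounds |st(z)| from below by a constant independent of eps, of the
      boxes and of z.
    For small eps the second term is smaller than the first, and s(t, z) is
    not 0 ([s_poly_stable]).

    Existence of boxes.  Every point of V(I) has a coordinate of modulus > 1,
    and interval evaluation on a box converges, as the box shrinks to a point,
    to the value at that point ([ieval_lipschitz]); hence squares centred at
    rational approximations of the roots work as soon as they are small.  If
    the approximation is an odd function of each coordinate, the centres of
    conjugate roots are conjugate; the products defining ft and st are then
    invariant under conjugation, and their coefficients, which lie in Q(i),
    are rational ([prod_descent], [construction_exists]). *)

(** * Properties that hold for all small parameters *)

Definition for_small (R : numDomainType) (P : R -> Prop) : Prop :=
  exists2 e0 : R, 0 < e0 & forall e, 0 < e -> e <= e0 -> P e.

Lemma for_smallI (R : realDomainType) (P Q : R -> Prop) :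
  for_small P -> for_small Q -> for_small (fun e => P e /\ Q e).
Proof.
move=> [a a0 Pa] [b b0 Qb]; exists (Num.min a b); first by rewrite lt_min a0.
by move=> e e0; rewrite le_min => /andP[ea eb]; split; [apply: Pa|apply: Qb].
Qed.

Lemma for_small_forall (R : realDomainType) (I : finType) (P : I -> R -> Prop) :
  (forall i, for_small (P i)) -> for_small (fun e => forall i, P i e).
Proof.
move=> H; have [b b0 Pb] := fin_all_exists2 H.
exists (\big[Num.min/1]_i b i).
  by apply: (big_ind (fun x => 0 < x)) => // x y x0 y0; rewrite lt_min x0.
move=> e e0 eb i; apply: Pb => //; apply: le_trans eb _.
exact: bigmin_le_cond.
Qed.

Lemma for_small_impl (R : numDomainType) (A : bool) (P : R -> Prop) :
  (A -> for_small P) -> for_small (fun e => A -> P e).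
Proof.
case: A => [/(_ isT)[b b0 Pb]|_]; last by exists 1.
by exists b => // e ? ? _; apply: Pb.
Qed.

Lemma for_small_mull (R : realFieldType) (c m : R) :
  0 < m -> for_small (fun e => c * e <= m).
Proof.
move=> m0; have c1 : 0 < `|c| + 1 by rewrite ltr_wpDl.
exists (m / (`|c| + 1)) => [|e e0]; first by rewrite divr_gt0.
rewrite ler_pdivlMr // => /(le_trans _); apply.
rewrite mulrC ler_wpM2l ?(ltW e0) // (le_trans (ler_norm c)) //.
by rewrite lerDl.
Qed.

(** The order of R[i] is partial, but the two bounds are comparable with 0 and
    hence real. *)
Lemma for_small_mulC (R : rcfType) (c m : R[i]) :
  0 <= c -> 0 < m -> for_small (fun e : R => c * e%:C <= m).
Proof.
move=> /ger0_real/complex_realP[c' ->] m0.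
have /complex_realP[m' mE] := gtr0_real m0.
rewrite mE ltcR in m0 *.
have [e0 e00 H] := for_small_mull c' m0.
by exists e0 => // e ? ?; rewrite -rmorphM lecR H.
Qed.

(** * Bounds for polynomials and products *)

Lemma mulr_distE (A : comNzRingType) (a b x y : A) :
  a * b - x * y = (a - x) * (b - y) + x * (b - y) + (a - x) * y.
Proof. ring. Qed.

(** The quotient of p(x) - p(y) by x - y is a polynomial in both variables, so
    that one bound serves for all x and y in a ball. *)
Lemma bounded_difference_quotient (C : numFieldType) (p : {poly C}) (B : C) :
  0 <= B -> exists2 M : C, 0 <= M &
    forall y : C, `|y| <= B ->
    exists2 q : {poly C}, p - p.[y]%:P = q * ('X - y%:P) &
      forall x : C, `|x| <= B -> `|q.[x]| <= M.
Proof.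
move=> B0; elim/poly_ind: p => [|p c [M M0 IH]].
  exists 0 => // y _; exists 0; first by rewrite horner0 subr0 mul0r.
  by move=> x _; rewrite horner0 normr0.
(* The difference quotient at 0 bounds p itself. *)
have bp x : `|x| <= B -> `|p.[x]| <= `|p.[0]| + M * B.
  move=> xB; have [|q qE qM] := IH 0; first by rewrite normr0.
  have /(congr1 (horner^~ x)) := qE; rewrite !hornerE subr0.
  move=> /(canRL (subrK _)) ->; rewrite addrC (le_trans (ler_normD _ _)) //.
  by rewrite lerD2l normrM ler_pM // qM.
exists (M * B + (`|p.[0]| + M * B)).
  by rewrite !addr_ge0 ?mulr_ge0.
move=> y yB; have [q qE qM] := IH y yB.
exists (q * 'X + p.[y]%:P) => [|x xB].
  have -> : p = q * ('X - y%:P) + p.[y]%:P by rewrite -qE subrK.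
  rewrite !hornerE subrr mulr0 add0r !polyCD !polyCM.
  by rewrite !mulrDl !mulrDr; ring.
rewrite hornerD hornerMX hornerC (le_trans (ler_normD _ _)) // lerD ?bp //.
by rewrite normrM ler_pM // qM.
Qed.

Lemma poly_lipschitz (C : numFieldType) (p : {poly C}) (B : C) : 0 <= B ->
  exists2 M : C, 0 <= M & forall x y : C, `|x| <= B -> `|y| <= B ->
    `|p.[x] - p.[y]| <= M * `|x - y|.
Proof.
move=> /(bounded_difference_quotient p)[M M0 H]; exists M => // x y xB yB.
have [q /(congr1 (horner^~ x)) qE qM] := H y yB.
rewrite !hornerE in qE; rewrite qE normrM ler_wpM2r // qM //.
Qed.

(** Changing the factors one at a time costs e * K^(#|I| - 1) each; the
    exponent #|I| is enough since 1 <= K, and avoids a predecessor. *)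
Lemma ler_dist_prod (C : numDomainType) (I : finType) (F G : I -> C) (K e : C) :
  1 <= K -> 0 <= e -> (forall i, `|F i| <= K) -> (forall i, `|G i| <= K) ->
  (forall i, `|F i - G i| <= e) ->
  `|\prod_i F i - \prod_i G i| <= #|I|%:R * K ^+ #|I| * e.
Proof.
move=> K1 e0 FK GK FGe; have K0 : 0 <= K by rewrite (le_trans _ K1).
rewrite -[\prod_i F i]big_enum -[\prod_i G i]big_enum cardE.
move: (enum _) => s.
elim: s => [|i s IHs]; first by rewrite !big_nil subrr normr0 mul0r mul0r.
have GKs : `|\prod_(i <- s) G i| <= K ^+ size s.
  elim: s {IHs} => [|j s IHs]; first by rewrite big_nil normr1.
  by rewrite big_cons normrM exprS ler_pM.
rewrite !big_cons /=; set P := \prod_(j <- s) F j in IHs *.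
set Q := \prod_(j <- s) G j in IHs GKs *.
have -> : F i * P - G i * Q = F i * (P - Q) + (F i - G i) * Q by ring.
rewrite (le_trans (ler_normD _ _)) // !normrM.
apply: (@le_trans _ _ (K * ((size s)%:R * K ^+ size s * e) + e * K ^+ size s)).
  by rewrite lerD // ler_pM.
rewrite exprS -subr_ge0 -natr1.
have -> : ((size s)%:R + 1) * (K * K ^+ size s) * e -
  (K * ((size s)%:R * K ^+ size s * e) + e * K ^+ size s)
  = (K - 1) * K ^+ size s * e by ring.
by rewrite !mulr_ge0 ?exprn_ge0 // subr_ge0.
Qed.

(** * Polynomials in t and z, and the ideal I_r *)

Lemma mpoly_ring_ind (n : nat) (A : nzRingType) (P : {mpoly A[n]} -> Prop) :
  (forall c, P c%:MP) -> (forall i, P 'X_i) ->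
  (forall p q, P p -> P q -> P (p + q)) ->
  (forall p q, P p -> P q -> P (p * q)) -> forall p, P p.
Proof.
move=> PC PX PD PM p; rewrite [p]mpolyE; elim/big_ind: _ => [||m _].
- by rewrite -mpolyC0.
- exact: PD.
rewrite -mul_mpolyC; apply: (PM) => //; rewrite mpolyXE_id.
elim/big_ind: _ => [||i _]; [by rewrite -mpolyC1|exact: PM|].
elim: (m i) => [|k IHk]; first by rewrite expr0 -mpolyC1.
by rewrite exprS; apply: (PM).
Qed.

Lemma mpoly_rmorph_ext (n : nat) (A B : nzRingType)
    (F G : {rmorphism {mpoly A[n]} -> B}) :
  (forall c, F c%:MP = G c%:MP) -> (forall i, F 'X_i = G 'X_i) -> F =1 G.
Proof.
move=> FGC FGX; elim/mpoly_ring_ind => // P Q FGP FGQ.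
  by rewrite !rmorphD FGP FGQ.
by rewrite !rmorphM FGP FGQ.
Qed.

Lemma in_ideal0 (A : comNzRingType) (J : finType) (gen : J -> A) :
  in_ideal gen 0.
Proof. by exists (fun=> 0); rewrite big1 // => j _; rewrite mul0r. Qed.

Lemma in_idealD (A : comNzRingType) (J : finType) (gen : J -> A) p q :
  in_ideal gen p -> in_ideal gen q -> in_ideal gen (p + q).
Proof.
move=> [c ->] [e ->]; exists (fun j => c j + e j).
by rewrite -big_split; apply: eq_bigr => j _; rewrite mulrDl.
Qed.

Lemma in_idealM (A : comNzRingType) (J : finType) (gen : J -> A) p q :
  in_ideal gen q -> in_ideal gen (p * q).
Proof.
move=> [c ->]; exists (fun j => p * c j).
by rewrite big_distrr; apply: eq_bigr => j _; apply: mulrA.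
Qed.

Lemma in_ideal_gen (A : comNzRingType) (J : finType) (gen : J -> A) j :
  in_ideal gen (gen j).
Proof.
exists (fun k => (k == j)%:R); rewrite (bigD1 j) //= eqxx mul1r big1 ?addr0 //.
by move=> k /negPf ->; rewrite mul0r.
Qed.

Section Embeddings.
Context (n : nat).

Lemma emb_tB : {morph @emb_t n : p q / p - q}.
Proof. by move=> p q; rewrite /emb_t rmorphB hornerD hornerN. Qed.
Lemma emb_tD : {morph @emb_t n : p q / p + q}.
Proof. by move=> p q; rewrite /emb_t rmorphD hornerD. Qed.
Lemma emb_tM : {morph @emb_t n : p q / p * q}.
Proof. by move=> p q; rewrite /emb_t rmorphM hornerM. Qed.
Lemma emb_tC c : emb_t n c%:P = c%:MP.
Proof. by rewrite /emb_t map_polyC hornerC. Qed.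

(** The polynomials P with P(z) = P(g(t)) modulo I_r form a subring, which
    contains the constants and, by definition of I_r, the variables. *)
Lemma emb_z_eq_emb_t (f : {poly rat}) (g : 'I_n -> {poly rat}) P :
  in_ideal (Ir_gen f g) (emb_z P - emb_t n (mmap polyC g P)).
Proof.
elim/mpoly_ring_ind: P => [c|i|P Q IHP IHQ|P Q IHP IHQ].
- rewrite /emb_z comp_mpolyC mmapC emb_tC subrr; exact: in_ideal0.
- rewrite /emb_z comp_mpolyXU mmapX mmap1U -tnth_nth tnth_mktuple.
  exact: (in_ideal_gen (Ir_gen f g) (Some i)).
- rewrite /emb_z !rmorphD /= emb_tD opprD addrACA; exact: in_idealD.
rewrite /emb_z !rmorphM /= emb_tM.
set a := P \mPo _ in IHP *; set b := Q \mPo _ in IHQ *.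
set x := emb_t _ _ in IHP *; set y := emb_t _ _ in IHQ *.
rewrite mulr_distE [(a - x) * y]mulrC.
by do ?apply: in_idealD; apply: in_idealM.
Qed.

End Embeddings.

Lemma ratrC (R : realType) (x : rat) : ratr x = (ratr x : R)%:C :> R[i].
Proof. by rewrite -(fmorph_eq_rat (real_complex R \o ratr)). Qed.

Section Evaluation.
Context (R : realType) (n : nat) (z : 'I_n -> R[i]).
Implicit Types p q : {mpoly rat[n]}.

Lemma eval_mpolyD p q :
  Defs.mevalC (p + q) z = Defs.mevalC p z + Defs.mevalC q z.
Proof. by rewrite /Defs.mevalC raddfD mevalD. Qed.

Lemma eval_mpolyB p q :
  Defs.mevalC (p - q) z = Defs.mevalC p z - Defs.mevalC q z.
Proof. by rewrite /Defs.mevalC raddfB mevalB. Qed.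

Lemma eval_mpolyM p q :
  Defs.mevalC (p * q) z = Defs.mevalC p z * Defs.mevalC q z.
Proof.
rewrite /Defs.mevalC -mevalM; congr meval.
exact: (rmorphM (map_mpoly (ratr : rat -> R[i]))).
Qed.

Lemma eval_mpolyC c : Defs.mevalC c%:MP z = ratr c.
Proof. by rewrite /Defs.mevalC map_mpolyC mevalC. Qed.

Lemma eval_linear_form (a : 'I_n -> rat) :
  Defs.mevalC (\sum_i a i *: 'X_i) z = linear_form a z.
Proof.
rewrite /linear_form; elim/big_rec2: _ => [|i y p _ <-].
  by rewrite -mpolyC0 eval_mpolyC rmorph0.
by rewrite eval_mpolyD /Defs.mevalC map_mpolyZ map_mpolyX mevalZ mevalXU.
Qed.

End Evaluation.

Lemma mevalC_subst_emb_z (R : realType) (n : nat) (a : 'I_n -> rat)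
    (P : {mpoly rat[n]}) (z : 'I_n -> R[i]) :
  Defs.mevalC (subst_t a (emb_z P)) z = Defs.mevalC P z.
Proof.
pose lz := [tuple ('X_(lift ord0 i) : {mpoly rat[n.+1]}) | i < n].
pose lt := [tuple (if unlift ord0 j is Some i then 'X_i
                   else \sum_i a i *: 'X_i : {mpoly rat[n]}) | j < n.+1].
suff E : comp_mpoly lt (comp_mpoly lz P) = P by rewrite -{2}E.
apply: (mpoly_rmorph_ext (F := comp_mpoly lt \o comp_mpoly lz) (G := idfun)).
  by move=> c /=; rewrite !comp_mpolyC.
move=> i /=; rewrite comp_mpolyXU -tnth_nth tnth_mktuple comp_mpolyXU -tnth_nth.
by rewrite tnth_mktuple liftK.
Qed.

Lemma mevalC_subst_emb_t (R : realType) (n : nat) (a : 'I_n -> rat)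
    (q : {poly rat}) (z : 'I_n -> R[i]) :
  Defs.mevalC (subst_t a (emb_t n q)) z = pevalC q (linear_form a z).
Proof.
rewrite /subst_t /pevalC; set lt := [tuple _ | j < _].
elim/poly_ind: q => [|q c IHq].
  by rewrite /emb_t !rmorph0 !horner0 comp_mpoly0 -mpolyC0 eval_mpolyC rmorph0.
have XE : emb_t n 'X = 'X_ord0 by rewrite /emb_t map_polyX hornerX.
rewrite emb_tD emb_tM emb_tC XE comp_mpolyD (rmorphM (comp_mpoly lt)).
rewrite [LHS]eval_mpolyD [X in X + _]eval_mpolyM comp_mpolyC eval_mpolyC.
rewrite [X in X * _]IHq rmorphD rmorphM /= map_polyX map_polyC !hornerE.
congr (_ * _ + _); rewrite comp_mpolyXU -tnth_nth tnth_mktuple unlift_none.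
exact: eval_linear_form.
Qed.

Lemma map_mmap_polyC (C : fieldType) (h : {rmorphism rat -> C}) (n : nat)
    (g : 'I_n -> {poly rat}) (P : {mpoly rat[n]}) :
  map_poly h (mmap polyC g P) =
  mmap polyC (fun i => map_poly h (g i)) (map_mpoly h P).
Proof.
apply: (mpoly_rmorph_ext (F := map_poly h \o mmap polyC g)
  (G := mmap polyC (fun i => map_poly h (g i)) \o map_mpoly h)) => [c|i] /=.
  by rewrite map_mpolyC !mmapC map_polyC.
by rewrite map_mpolyX !mmapX !mmap1U.
Qed.

(** * Interval arithmetic *)

Section Interval.
Context (R : realType).
Implicit Types (I J : set R) (e : iexpr) (w : 'I_2 -> R).

Definition iexpr_value (w : 'I_2 -> R) (e : iexpr) : R :=
  (map_mpoly ratr (iexpr_poly e)).@[w].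

Lemma iexpr_valueD w e1 e2 :
  iexpr_value w (Defs.IAdd e1 e2) = iexpr_value w e1 + iexpr_value w e2.
Proof. by rewrite /iexpr_value /= (rmorphD (map_mpoly _)) mevalD. Qed.

Lemma iexpr_valueM w e1 e2 :
  iexpr_value w (Defs.IMul e1 e2) = iexpr_value w e1 * iexpr_value w e2.
Proof. by rewrite /iexpr_value /= (rmorphM (map_mpoly _)) mevalM. Qed.

Lemma iexpr_valueN w e : iexpr_value w (Defs.IOpp e) = - iexpr_value w e.
Proof. by rewrite /iexpr_value /= (rmorphN (map_mpoly _)) mevalN. Qed.

Lemma iexpr_valueX w e k : iexpr_value w (Defs.IPow e k) = iexpr_value w e ^+ k.
Proof. by rewrite /iexpr_value /= !rmorphXn. Qed.

Lemma iexpr_value_cst w c : iexpr_value w (Defs.ICst c) = ratr c.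
Proof. by rewrite /iexpr_value /= map_mpolyC mevalC. Qed.

Lemma iexpr_value_x1 w : iexpr_value w IX1 = w ord0.
Proof. by rewrite /iexpr_value /= map_mpolyX mevalXU. Qed.

Lemma iexpr_value_x2 w : iexpr_value w IX2 = w ord_max.
Proof. by rewrite /iexpr_value /= map_mpolyX mevalXU. Qed.

Definition iexpr_valueE :=
  (iexpr_valueD, iexpr_valueM, iexpr_valueN, iexpr_valueX,
   iexpr_value_cst, iexpr_value_x1, iexpr_value_x2).

Lemma ieval_value I J w e :
  I (w ord0) -> J (w ord_max) -> ieval I J e (iexpr_value w e).
Proof.
move=> Iw Jw.
elim: e => [c|||e IHe|e1 IH1 e2 IH2|e1 IH1 e2 IH2|e IHe k] /=;
  rewrite iexpr_valueE //.
- by exists (iexpr_value w e).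
- by exists (iexpr_value w e1) => //; exists (iexpr_value w e2).
- by exists (iexpr_value w e1) => //; exists (iexpr_value w e2).
by exists (iexpr_value w e).
Qed.

(** Interval arithmetic loses the correlation between the operands, but each
    operation is Lipschitz on bounded sets, so that the result stays within a
    distance of the exact value that is proportional to the size t of the
    box. *)
Lemma ieval_lipschitz w e : exists2 K : R, 0 <= K &
  forall (I J : set R) (t : R), 0 <= t <= 1 ->
    (forall x, I x -> `|x - w ord0| <= t) ->
    (forall x, J x -> `|x - w ord_max| <= t) ->
    forall x, ieval I J e x -> `|x - iexpr_value w e| <= K * t.
Proof.
elim: e => [c|||e [K K0 HK]|e1 [K1 K10 H1] e2 [K2 K20 H2]
           |e1 [K1 K10 H1] e2 [K2 K20 H2]|e [K K0 HK] k] /=;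
  rewrite iexpr_valueE.
- exists 0 => // I J t /andP[t0 _] _ _ x ->.
  by rewrite subrr normr0 mul0r.
- by exists 1 => // I J t _ HI _ x Ix; rewrite mul1r HI.
- by exists 1 => // I J t _ _ HJ x Jx; rewrite mul1r HJ.
- exists K => // I J t t01 HI HJ _ [x Ex <-].
  by rewrite -opprD normrN; apply: HK Ex.
- exists (K1 + K2); first exact: addr_ge0.
  move=> I J t t01 HI HJ _ [x Ex [y Ey <-]].
  rewrite opprD addrACA mulrDl (le_trans (ler_normD _ _)) //.
  by rewrite lerD //; [apply: H1 Ex|apply: H2 Ey].
- set v1 := iexpr_value w e1 in H1 *; set v2 := iexpr_value w e2 in H2 *.
  exists (K1 * K2 + `|v1| * K2 + K1 * `|v2|).
    by rewrite !addr_ge0 // mulr_ge0.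
  move=> I J t t01 HI HJ _ [x Ex [y Ey <-]].
  have := H1 _ _ _ t01 HI HJ _ Ex; have := H2 _ _ _ t01 HI HJ _ Ey.
  case/andP: t01 => t0 t1 yv xv; rewrite mulr_distE.
  rewrite (le_trans (ler_normD _ _)) // [leRHS]mulrDl lerD //; last first.
    by rewrite normrM mulrAC ler_wpM2r.
  rewrite (le_trans (ler_normD _ _)) // [leRHS]mulrDl lerD //; last first.
    by rewrite normrM -mulrA ler_wpM2l.
  rewrite normrM (le_trans (ler_pM _ _ xv yv)) //.
  by rewrite mulrACA ler_wpM2l ?mulr_ge0 // -[leRHS]mulr1 ler_wpM2l.
set v := iexpr_value w e in HK *.
have [|M M0 HM] := @poly_lipschitz R 'X^k (`|v| + K); first by rewrite addr_ge0.
exists (M * K); first exact: mulr_ge0.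
move=> I J t t01 HI HJ _ [x Ex <-].
have := HK _ _ _ t01 HI HJ _ Ex => xv.
have {HM} := HM x v; rewrite !hornerXn => HM.
rewrite -mulrA (le_trans (HM _ _)) ?lerDl // ?ler_wpM2l //.
rewrite -[x](subrK v) (le_trans (ler_normD _ _)) // addrC lerD2l.
by rewrite (le_trans xv) // -[leRHS]mulr1 ler_wpM2l //; case/andP: t01.
Qed.

Lemma ieval_box_pos (c : R[i]) (e : iexpr) :
  0 < iexpr_value (fun i => if i == ord0 then Re c else Im c) e ->
  for_small (fun t : R => forall u v,
    (forall x, Re u <= x <= Re v -> `|x - Re c| <= t) ->
    (forall x, Im u <= x <= Im v -> `|x - Im c| <= t) ->
    ieval_box e u v `<=` [set x | 0 < x]).
Proof.
set w := fun i => _; move=> w0; have [K K0 HK] := ieval_lipschitz w e.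
have [e0 e00 He0] : for_small (fun t => K * t <= iexpr_value w e / 2).
  by apply: for_small_mull; rewrite divr_gt0.
exists (Num.min e0 1) => [|t t0]; first by rewrite lt_min e00 ltr01.
rewrite le_min => /andP[te0 t1] u v Hu Hv x Ex /=.
have t01 : 0 <= t <= 1 by rewrite ltW.
have := HK _ _ _ t01 Hu Hv _ Ex; have := He0 _ t0 te0.
rewrite ler_norml => ? /andP[]; lra.
Qed.

Lemma Cpoly_value (g : {poly rat}) (w : 'I_2 -> R) :
  ((map_mpoly ratr (Cpoly g)).@[w])%:C =
  `|pevalC g (w ord0 +i* w ord_max)| ^+ 2 - 1.
Proof.
rewrite re_im_polyE -add_Re2_Im2 /Cpoly /=.
rewrite (rmorphB (map_mpoly _)) (rmorphD (map_mpoly _)) rmorph1.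
rewrite 2!(rmorphXn (map_mpoly _)) mevalB mevalD 2!(rmorphXn (meval w)) meval1.
by rewrite [LHS]rmorphB rmorph1.
Qed.

End Interval.

(** * Products invariant under conjugation *)

(** Galois descent from S[i] to S, with phi : S -> T in the role of the
    inclusion and sigma in that of conjugation: all factors lie in
    phi(S) + iota phi(S), hence so does the product, phi u + iota phi v;
    as sigma permutes the factors, phi u - iota phi v = phi u + iota phi v,
    and 2 is invertible. *)
Lemma prod_descent (S T : comNzRingType) (phi : {rmorphism S -> T})
    (sigma : {rmorphism T -> T}) (iota : T) (half : S)
    (J : finType) (x : J -> T) (tau : J -> J) :
  iota * iota = -1 -> sigma iota = - iota -> half + half = 1 ->
  (forall s, sigma (phi s) = phi s) ->
  (forall j, exists u v, x j = phi u + iota * phi v) ->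
  injective tau -> (forall j, sigma (x j) = x (tau j)) ->
  exists s, phi s = \prod_j x j.
Proof.
move=> ii si hh sphi xE tau_inj sx.
have [u [v uvE]] : exists u v, \prod_j x j = phi u + iota * phi v.
  elim/big_ind: _ => [|a b [u [v ->]] [u' [v' ->]]|j _]; last exact: xE.
    by exists 1, 0; rewrite rmorph1 rmorph0 mulr0 addr0.
  exists (u * u' - v * v'), (u * v' + v * u').
  rewrite rmorphB rmorphD !rmorphM.
  have -> : phi u * phi u' - phi v * phi v' =
    phi u * phi u' + iota * iota * (phi v * phi v') by rewrite ii mulN1r.
  ring.
have : sigma (\prod_j x j) = \prod_j x j.
  rewrite rmorph_prod [RHS](reindex_inj tau_inj) /=.
  by apply: eq_bigr => j _; rewrite sx.
rewrite uvE rmorphD rmorphM !sphi si mulNr => /addrI/eqP.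
rewrite eq_sym -subr_eq0 opprK => /eqP iv2.
exists u; suff -> : iota * phi v = 0 by rewrite addr0.
by rewrite -[LHS]mul1r -(rmorph1 phi) -hh rmorphD mulrDl -mulrDr iv2 mulr0.
Qed.

Section Gaussian.
Context (R : realType).
Implicit Types (c x : R[i]) (q : {poly rat}).

Lemma conjc_ratr (s : rat) : (ratr s : R[i])^* = ratr s.
Proof. by rewrite ratrC conjc_real. Qed.

Lemma normc_conj x : `|x^*| = `|x|.
Proof. by rewrite !normc_def; case: x => a b /=; rewrite sqrrN. Qed.

Lemma pevalC_conj q x : pevalC q x^* = (pevalC q x)^*.
Proof.
rewrite /pevalC -horner_map -map_poly_comp; congr _.[_].
by apply: eq_map_poly => s /=; rewrite conjc_ratr.
Qed.

Lemma rational_pointE c :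
  rational_point c <-> exists u v : rat, c = ratr u + 'i * ratr v.
Proof.
split=> [] [u [v ->]]; exists u, v; rewrite !ratrC; simpc => //.
Qed.

Lemma rational_point_peval q c :
  rational_point c -> rational_point (pevalC q c).
Proof.
move=> [x [y cE]]; rewrite /pevalC.
elim/poly_ind: q => [|q s [u [v IHq]]].
  by exists 0, 0; rewrite rmorph0 horner0 rmorph0.
exists (u * x - v * y + s), (u * y + v * x).
rewrite rmorphD rmorphM /= map_polyX map_polyC !hornerE /= IHq [in LHS]cE.
by rewrite ratrC !(rmorphD, rmorphN, rmorphM) /=; simpc.
Qed.

Let half : (1 / 2 + 1 / 2 : rat) = 1. Proof. by []. Qed.

Lemma rational_prod_poly (J : finType) (c : J -> R[i]) (tau : J -> J) :
  injective tau -> (forall j, rational_point (c j)) ->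
  (forall j, c (tau j) = (c j)^*) ->
  exists h : {poly rat}, map_poly ratr h = \prod_j ('X - (c j)%:P).
Proof.
move=> tau_inj c_rat c_tau.
apply: (prod_descent (phi := map_poly ratr) (sigma := map_poly conjc)
  (iota := 'i%:P) (half := (1 / 2)%:P) _ _ _ _ _ tau_inj).
- by rewrite -polyCM -expr2 sqr_i polyCN.
- by rewrite /= map_polyC /= -polyCN; congr _%:P; simpc.
- by rewrite -polyCD half.
- move=> s /=; rewrite -map_poly_comp; apply: eq_map_poly => x /=.
  exact: conjc_ratr.
- move=> j; have /rational_pointE[u [v ->]] := c_rat j.
  exists ('X - u%:P), (- v%:P); rewrite /= rmorphB rmorphN /= map_polyX.
  by rewrite !map_polyC mulrN -polyCM -addrA -opprD -polyCD.
by move=> j /=; rewrite rmorphB /= map_polyX map_polyC c_tau.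
Qed.

Lemma rational_prod_mpoly (n : nat) (J : finType) (k : J -> 'I_n)
    (c : J -> R[i]) (tau : J -> J) :
  injective tau -> (forall j, rational_point (c j)) ->
  (forall j, c (tau j) = (c j)^*) -> (forall j, k (tau j) = k j) ->
  exists h : {mpoly rat[n]},
    map_mpoly ratr h = \prod_j ('X_(k j) - (c j)%:MP).
Proof.
move=> tau_inj c_rat c_tau k_tau.
apply: (prod_descent (phi := map_mpoly ratr) (sigma := map_mpoly conjc)
  (iota := 'i%:MP) (half := (1 / 2)%:MP) _ _ _ _ _ tau_inj).
- by rewrite -mpolyCM -expr2 sqr_i mpolyCN.
- by rewrite /= map_mpolyC /= -mpolyCN; congr _%:MP; simpc.
- by rewrite -mpolyCD half.
- apply: (mpoly_rmorph_ext (F := map_mpoly conjc \o map_mpoly ratr)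
    (G := map_mpoly ratr)) => [s|i] /=.
    by rewrite !map_mpolyC /= conjc_ratr.
  by rewrite !map_mpolyX.
- move=> j; have /rational_pointE[u [v ->]] := c_rat j.
  exists ('X_(k j) - u%:MP), (- v%:MP); rewrite /= rmorphB rmorphN /=.
  by rewrite map_mpolyX !map_mpolyC mulrN -mpolyCM -addrA -opprD -mpolyCD.
by move=> j /=; rewrite rmorphB /= map_mpolyX map_mpolyC c_tau k_tau.
Qed.

End Gaussian.

(** * Existence of the boxes *)

(** Oddness makes the rounding of complex numbers commute with conjugation. *)
Lemma odd_rounding (R : realType) (e : R) : 0 < e ->
  exists2 rd : R -> rat, (forall x : R, `|ratr (rd x) - x| < e) &
    forall x : R, rd (- x) = - rd x.
Proof.
move=> e0; have ex (x : R) : exists s : rat, `|ratr s - x| < e.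
  have [|s] := @rat_in_itvoo R (x - e) (x + e); first by lra.
  by rewrite in_itv /= -ltr_distlC distrC; exists s.
have [r rP] : exists r : R -> rat, forall x, `|ratr (r x) - x| < e.
  by exists (fun x => xchoose (ex x)) => x; apply: xchooseP (ex x).
pose rd (x : R) : rat :=
  if x == 0 then 0 else if 0 < x then r x else - r (- x).
have rdN (x : R) : 0 < x -> rd (- x) = - rd x.
  by move=> x0; rewrite /rd oppr_eq0 gt_eqF // x0 oppr_gt0 ltNge ltW //= opprK.
exists rd => x; last first.
  have [x0|x0|->] := ltrgtP x 0; last by rewrite oppr0 /rd eqxx oppr0.
    by have := rdN (- x); rewrite opprK oppr_gt0 => /(_ x0) ->; rewrite opprK.
  exact: rdN.
rewrite /rd; have [x0|x0|->] := ltrgtP x 0.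
- by rewrite rmorphN -opprD normrN; have := rP (- x); rewrite opprK.
- exact: rP.
by rewrite rmorph0 subrr normr0.
Qed.

Section Existence.
Context (R : realType) (n d : nat) (wr : {mpoly rat[2]} -> iexpr).
Context (f : {poly rat}) (g : 'I_n -> {poly rat}) (gamma : 'I_d -> R[i]).
Hypothesis wrK : forall h, iexpr_poly (wr h) = h.
Hypothesis f_factor : map_poly ratr f = \prod_(i < d) ('X - (gamma i)%:P).

Definition coordinates (c : R[i]) (i : 'I_2) : R :=
  if i == ord0 then Re c else Im c.

Lemma Cpoly_gt0 (q : {poly rat}) (c : R[i]) :
  (0 < iexpr_value (coordinates c) (wr (Cpoly q))) = (1 < `|pevalC q c|).
Proof.
rewrite -ltcR /iexpr_value wrK Cpoly_value rmorph0 subr_gt0 expr_gt1 //.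
by case: c.
Qed.

Lemma pevalC_root x : (pevalC f x = 0) <-> exists i, x = gamma i.
Proof.
rewrite /pevalC f_factor horner_prod; split=> [/eqP/prodf_eq0[i _]|[i ->]].
  by rewrite !hornerE subr_eq0 => /eqP ->; exists i.
by rewrite (bigD1 i) //= !hornerE subrr mul0r.
Qed.

Hypothesis gamma_inj : injective gamma.

(** f has rational coefficients, so conjugation maps its roots to its roots. *)
Lemma conj_perm : exists2 tau : 'I_d -> 'I_d, injective tau &
  forall i, gamma (tau i) = (gamma i)^*.
Proof.
have /fin_all_exists[tau tauE] : forall i, exists j, gamma j = (gamma i)^*.
  move=> i; have [|j jE] := (pevalC_root (gamma i)^*).1; last by exists j.
  by rewrite pevalC_conj (pevalC_root _).2 ?conjc0 //; exists i.
exists tau => // i j /(congr1 gamma); rewrite !tauE => /(congr1 conjc).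
by rewrite !conjcK => /gamma_inj.
Qed.

Hypothesis g_big : forall i, exists k, 1 < `|pevalC (g k) (gamma i)|.

(** The box of gamma_i is the square of half-width q centred at the rounding
    of gamma_i, with 2 q below a threshold that ensures all the conditions. *)
Lemma construction_exists (eps : R) :
  0 < eps -> inhabited (construction wr f g gamma eps).
Proof.
move=> eps0; have [tau tau_inj tauE] := conj_perm.
(* [xchoose] depends only on the predicate, and conjugate roots satisfy the same
   one: their indices are equal. *)
pose k i := xchoose (g_big i).
have k1 i : 1 < `|pevalC (g (k i)) (gamma i)| by exact: xchooseP (g_big i).
have k_tau i : k (tau i) = k i.
  by apply: eq_xchoose => j; rewrite tauE pevalC_conj normc_conj.
have [e0 e00 He] : for_small (fun t : R =>
    [/\ forall i u v,
      (forall x, Re u <= x <= Re v -> `|x - Re (gamma i)| <= t) ->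
      (forall x, Im u <= x <= Im v -> `|x - Im (gamma i)| <= t) ->
      ieval_box (wr (Cpoly (g (k i)))) u v `<=` [set x | 0 < x],
      forall i j, i != j ->
        2 * t <= Num.max `|Re (gamma i) - Re (gamma j)|
                          `|Im (gamma i) - Im (gamma j)| &
      t <= eps]).
  have H1 : for_small (fun t : R => forall i u v,
      (forall x, Re u <= x <= Re v -> `|x - Re (gamma i)| <= t) ->
      (forall x, Im u <= x <= Im v -> `|x - Im (gamma i)| <= t) ->
      ieval_box (wr (Cpoly (g (k i)))) u v `<=` [set x | 0 < x]).
    apply: for_small_forall => i; apply: ieval_box_pos.
    by rewrite -/(coordinates _) Cpoly_gt0.
  have H2 : for_small (fun t : R => forall i j, i != j ->
        2 * t <= Num.max `|Re (gamma i) - Re (gamma j)|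
                          `|Im (gamma i) - Im (gamma j)|).
    do 2!apply: for_small_forall => ?; apply: for_small_impl => ij.
    apply: for_small_mull; rewrite lt_max !normr_gt0 !subr_eq0 -negb_and.
    apply: contra ij => /andP[/eqP re /eqP im]; apply/eqP/gamma_inj/eqP.
    by rewrite eq_complex re im !eqxx.
  have [e1 e10 {}H1] := for_smallI H1 H2.
  exists (Num.min e1 eps); first by rewrite lt_min e10.
  move=> t t0; rewrite le_min => /andP[te1 teps].
  by have [? ?] := H1 t t0 te1; split.
have [|q] := @rat_in_itvoo R 0 (e0 / 2); first by rewrite divr_gt0.
rewrite in_itv /= => /andP[q0 qe0].
have [//|| H1 H2 H3] := He (2 * ratr q); first by rewrite mulr_gt0.
  lra.
have [rd rdP rdN] := odd_rounding q0.
pose lo i : R[i] :=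
  ratr (rd (Re (gamma i)) - q) +i* ratr (rd (Im (gamma i)) - q).
pose hi i : R[i] :=
  ratr (rd (Re (gamma i)) + q) +i* ratr (rd (Im (gamma i)) + q).
pose c i : R[i] := ratr (rd (Re (gamma i))) +i* ratr (rd (Im (gamma i))).
have midE i : midpoint (lo i) (hi i) = c i.
  rewrite /midpoint /lo /hi /c !(rmorphD, rmorphN) /=.
  apply: (canLR (mulfK _)); first by rewrite pnatr_eq0.
  rewrite -(rmorph_nat (real_complex R)); simpc; congr (_ +i* _); ring.
have c_rat i : rational_point (c i) by eexists; eexists.
have c_tau i : c (tau i) = (c i)^*.
  rewrite /c tauE; case: (gamma i) => x y /=.
  by rewrite rdN rmorphN.
have box_near i x : box (lo i) (hi i) x ->
    `|Re x - Re (gamma i)| < 2 * ratr q /\ `|Im x - Im (gamma i)| < 2 * ratr q.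
  have := rdP (Re (gamma i)); have := rdP (Im (gamma i)).
  rewrite /box /lo /hi /= !(rmorphD, rmorphN) /= !ltr_norml.
  move=> /andP[? ?] /andP[? ?] [/andP[? ?] /andP[? ?]].
  by split; apply/andP; split; lra.
have disj i j : i != j -> box (lo i) (hi i) `&` box (lo j) (hi j) = set0.
  move=> ij; rewrite -subset0 => x [/box_near[xi yi] /box_near[xj yj]].
  have := H2 i j ij; rewrite le_max => /orP[]; apply/negP; rewrite -ltNge.
    rewrite (le_lt_trans (ler_distD (Re x) _ _)) // distrC; lra.
  rewrite (le_lt_trans (ler_distD (Im x) _ _)) // distrC; lra.
have root i : box (lo i) (hi i) (gamma i).
  have := rdP (Re (gamma i)); have := rdP (Im (gamma i)).
  rewrite /box /lo /hi /= !(rmorphD, rmorphN) /= !ltr_norml.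
  by move=> /andP[? ?] /andP[? ?]; split; apply/andP; split; lra.
have [ft ftE] := rational_prod_poly tau_inj c_rat c_tau.
have [st stE] : exists h : {mpoly rat[n]}, map_mpoly ratr h =
    \prod_i ('X_(k i) - (pevalC (g (k i)) (c i))%:MP).
  apply: (rational_prod_mpoly tau_inj) => // i.
    exact: rational_point_peval.
  by rewrite k_tau c_tau pevalC_conj.
constructor; apply: (@Construction _ _ _ _ _ _ _ _ lo hi k ft st).
- by move=> i; rewrite /= !(rmorphD, rmorphN) /=; split; lra.
- by move=> i; split; eexists; eexists.
- exact: disj.
- exact: root.
- move=> i x xi /pevalC_root[j xj]; rewrite xj in xi *.
  have [->//|ij] := eqVneq i j; suff : set0 (gamma j) by [].
  by rewrite -(disj i j).
- move=> i; rewrite /width ge_max /lo /hi /= !(rmorphD, rmorphN) /=.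
  by rewrite !ler_norml; apply/andP; split; apply/andP; split; lra.
- move=> i; apply: H1 => x; have := rdP (Re (gamma i));
    have := rdP (Im (gamma i)); rewrite /lo /hi /= !(rmorphD, rmorphN) /=;
    rewrite !ltr_norml ler_norml => /andP[? ?] /andP[? ?] /andP[? ?];
    by apply/andP; split; lra.
- by rewrite ftE; apply: eq_bigr => i _; rewrite midE.
by rewrite stE; apply: eq_bigr => i _; rewrite midE.
Qed.

End Existence.

(** * Membership and stability *)

Section Stability.
Context (R : realType) (n d : nat) (wr : {mpoly rat[2]} -> iexpr).
Context (f : {poly rat}) (g : 'I_n -> {poly rat}) (gamma : 'I_d -> R[i]).
Hypothesis wrK : forall h, iexpr_poly (wr h) = h.
Hypothesis f_factor : map_poly ratr f = \prod_(i < d) ('X - (gamma i)%:P).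
Local Notation gC k := (map_poly (ratr : rat -> R[i]) (g k)).

Section Outcome.
Context (eps : R) (D : construction wr f g gamma eps).
Local Notation mid i := (midpoint (lo D i) (hi D i)).

(** Over R[i], substituting z = g(t) in stilde gives a multiple of ftilde, with
    the product of the difference quotients as cofactor. *)
Lemma mmap_stilde (q : 'I_d -> {poly R[i]}) :
  (forall i, gC (idx D i) - (gC (idx D i)).[mid i]%:P =
             q i * ('X - (mid i)%:P)) ->
  map_poly ratr (mmap polyC g (stilde D)) =
  (\prod_i q i) * map_poly ratr (ftilde D).
Proof.
move=> qE; rewrite map_mmap_polyC (stildeE D) ftildeE rmorph_prod -big_split.
apply: eq_bigr => i _; rewrite rmorphB /= mmapX mmap1U mmapC; exact: qE.
Qed.

Lemma ftilde_neq0 : map_poly ratr (ftilde D) != 0 :> {poly R[i]}.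
Proof. by rewrite ftildeE monic_neq0 // monic_prod_XsubC. Qed.

Lemma htildeE (q : 'I_d -> {poly R[i]}) :
  (forall i, gC (idx D i) - (gC (idx D i)).[mid i]%:P =
             q i * ('X - (mid i)%:P)) ->
  map_poly ratr (htilde D) = \prod_i q i.
Proof.
by move=> /mmap_stilde qE; rewrite map_divp qE mulpK // ftilde_neq0.
Qed.

Lemma htildeK : htilde D * ftilde D = mmap polyC g (stilde D).
Proof.
apply: divpK; rewrite -(dvdp_map (ratr : {rmorphism rat -> R[i]})).
have H i : exists q, gC (idx D i) - (gC (idx D i)).[mid i]%:P =
    q * ('X - (mid i)%:P).
  by apply/factor_theorem; rewrite rootE !hornerE subrr.
have [q qE] := fin_all_exists H.
by rewrite (mmap_stilde qE) dvdp_mull.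
Qed.

(** Since htilde ftilde = stilde(g(t)), one has
    s = htilde f + (stilde(z) - stilde(g(t))), and both summands lie in I_r. *)
Lemma s_poly_in_Ir : in_ideal (Ir_gen f g) (s_poly D).
Proof.
rewrite /s_poly mulrBr opprB addrCA -(emb_tM _ _ (ftilde D)) htildeK.
apply: in_idealD; last exact: emb_z_eq_emb_t.
exact: in_idealM (in_ideal_gen (Ir_gen f g) None).
Qed.

Lemma box_dist (u v x y : R[i]) :
  box u v x -> box u v y -> width u v <= eps -> `|x - y| <= 2 * eps%:C.
Proof.
move=> [/andP[x1 x2] /andP[x3 x4]] [/andP[y1 y2] /andP[y3 y4]].
rewrite ge_max => /andP[]; rewrite !ler_norml => /andP[_ w1] /andP[_ w2].
rewrite [x - y]complexE (le_trans (ler_normD _ _)) // mulrDl !mul1r.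
have i1 : `|'i : R[i]| = 1.
  by rewrite normc_def /= expr0n expr1n add0r sqrtr1.
have nR (s : R) : `|s%:C| = `|s|%:C :> R[i].
  by rewrite normc_def /= expr0n addr0 sqrtr_sqr.
move: x1 x2 x3 x4 y1 y2 y3 y4 w1 w2; rewrite normrM i1 mul1r !nR.
case: u v x y => [? ?] [? ?] [? ?] [? ?] /= *.
by rewrite lerD // lecR ler_norml; apply/andP; split; lra.
Qed.

Lemma mid_in_box i : box (lo D i) (hi D i) (mid i).
Proof.
have [] := box_valid D i; case: (lo D i) (hi D i) => [x1 x2] [y1 y2] lt1 lt2.
have -> : midpoint (x1 +i* x2) (y1 +i* y2) =
    ((x1 + y1) / 2) +i* ((x2 + y2) / 2).
  apply: (canLR (mulfK _)); first by rewrite pnatr_eq0.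
  rewrite -(rmorph_nat (real_complex R)); simpc; congr (_ +i* _); lra.
by rewrite /= in lt1 lt2; split; apply/andP; split => /=; lra.
Qed.

Lemma dist_mid_gamma i : `|mid i - gamma i| <= 2 * eps%:C.
Proof.
apply: box_dist (box_width D i); [exact: mid_in_box|exact: box_root].
Qed.

(** Evaluating C(g_{k_i}) at the root itself gives a point of the interval that
    is contained in the positive reals. *)
Lemma idx_gt1 i : 1 < `|(gC (idx D i)).[gamma i]|.
Proof.
have [/andP[x1 x2] /andP[x3 x4]] := box_root D i.
rewrite -[_.[_]]/(pevalC _ _) -(Cpoly_gt0 wrK).
apply: (box_positive (c := D) (i := i)); apply: ieval_value => /=;
  by rewrite /coordinates /= !ltW.
Qed.

Lemma eval_s_poly (a : 'I_n -> rat) (z : 'I_n -> R[i]) :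
  Defs.mevalC (subst_t a (s_poly D)) z =
  \prod_i (z (idx D i) - (gC (idx D i)).[mid i]) -
  pevalC (htilde D) (linear_form a z) *
    (\prod_i (linear_form a z - mid i) - \prod_i (linear_form a z - gamma i)).
Proof.
rewrite /s_poly -emb_tB -emb_tM /subst_t comp_mpolyB eval_mpolyB.
rewrite [X in X - _]mevalC_subst_emb_z [X in _ - X]mevalC_subst_emb_t.
have ev (c : 'I_d -> R[i]) x :
    (\prod_i ('X - (c i)%:P)).[x] = \prod_i (x - c i).
  by rewrite horner_prod; apply: eq_bigr => i _; rewrite !hornerE.
rewrite /pevalC rmorphM rmorphB /= f_factor ftildeE hornerM hornerD hornerN !ev.
congr (_ - _); rewrite /Defs.mevalC (stildeE D) (rmorph_prod (meval z)) /=.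
by apply: eq_bigr => i _; rewrite mevalB mevalXU mevalC.
Qed.

End Outcome.

Lemma norm_linear_form (a : 'I_n -> rat) (z : 'I_n -> R[i]) :
  closed_polydisc z -> `|linear_form a z| <= \sum_i `|ratr (a i)|.
Proof.
move=> z1; rewrite (le_trans (ler_norm_sum _ _ _)) // ler_sum // => i _.
by rewrite normrM -[leRHS]mulr1 ler_wpM2l ?z1.
Qed.

(** With B a bound for the moduli of t, of the roots and of the midpoints, M a
    bound for the difference quotients on the ball of radius B and m half of
    a common lower bound of |g_k(gamma_i)| - 1 over the pairs where it is
    positive, the threshold on eps makes |stilde(z)| >= m^d and
    |htilde(t) (ftilde(t) - f(t))| <= m^d / 2. *)
Lemma s_poly_stable (a : 'I_n -> rat) :
  for_small (fun eps : R => forall D : construction wr f g gamma eps,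
    stable R (subst_t a (s_poly D))).
Proof.
(* The summand 2 bounds the distance between a midpoint and its root when
   eps <= 1. *)
pose B : R[i] := \sum_i `|ratr (a i)| + (\sum_i `|gamma i| + 2).
have B1 : 0 <= \sum_i `|ratr (a i)| :> R[i] by apply: sumr_ge0.
have B2 : 0 <= \sum_i `|gamma i| by apply: sumr_ge0.
have B0 : 0 <= B by rewrite !addr_ge0.
have [Mk Mk0 HM] :=
  fin_all_exists2 (fun k => bounded_difference_quotient (gC k) B0).
pose M := \sum_k Mk k; have M0 : 0 <= M by apply: sumr_ge0.
have MkM k : Mk k <= M by rewrite /M (bigD1 k) //= lerDl sumr_ge0.
pose K := B + B + 1; have K1 : 1 <= K by rewrite lerDr addr_ge0.
have [delta delta0 Hdelta] : for_small (fun t : R => forall i k,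
    1 < `|(gC k).[gamma i]| -> 1 + t%:C <= `|(gC k).[gamma i]|).
  do 2!apply: for_small_forall => ?; apply: for_small_impl => gt1.
  rewrite -subr_gt0 in gt1.
  have [e0 e00 He] := for_small_mulC ler01 gt1.
  by exists e0 => // t t0 te; rewrite -lerBrDl -[t%:C]mul1r He.
have {}Hdelta := Hdelta _ delta0 (lexx _).
pose m : R[i] := delta%:C / 2.
have m0 : 0 < m by rewrite divr_gt0 // ltcR.
have [e1 e10 H1] : for_small (fun e : R => M * 2 * e%:C <= m).
  by apply: for_small_mulC; rewrite ?mulr_ge0.
have [e2 e20 H2] : for_small (fun e : R =>
    M ^+ d * (d%:R * K ^+ d) * 2 * e%:C <= m ^+ d / 2).
  apply: for_small_mulC; last by rewrite divr_gt0 // exprn_gt0.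
  by rewrite !mulr_ge0 ?exprn_ge0 // (le_trans ler01).
exists (Num.min 1 (Num.min e1 e2)); first by rewrite !lt_min ltr01 e10.
move=> eps eps0; rewrite !le_min => /and3P[eps1 epse1 epse2] D z z1.
have {}H1 := H1 _ eps0 epse1; have {}H2 := H2 _ eps0 epse2.
have epsC0 : 0 <= eps%:C :> R[i] by rewrite lecR ltW.
set T := linear_form a z.
have TB : `|T| <= B.
  by rewrite (le_trans (norm_linear_form a z1)) // lerDl addr_ge0.
have gB0 i : `|gamma i| + 2 <= B.
  by rewrite ler_wpDl // lerD2r (bigD1 i) //= lerDl sumr_ge0.
have gB i : `|gamma i| <= B by rewrite (le_trans _ (gB0 i)) // lerDl.
have mB i : `|midpoint (lo D i) (hi D i)| <= B.
  rewrite (le_trans _ (gB0 i)) // -[midpoint _ _](subrK (gamma i)).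
  rewrite (le_trans (ler_normD _ _)) // addrC lerD2l.
  rewrite (le_trans (dist_mid_gamma D i)) // -[leRHS]mulr1 ler_wpM2l //.
  by rewrite lecR.
have [q qE qM] := fin_all_exists2 (fun i => HM (idx D i) _ (mB i)).
have hM : `|pevalC (htilde D) T| <= M ^+ d.
  rewrite /pevalC (htildeE qE) horner_prod normr_prod.
  rewrite -[d in M ^+ d]card_ord -prodr_const ler_prod // => i _.
  by rewrite normr_ge0 (le_trans (qM i _ TB)).
have lower : m ^+ d <=
    `|\prod_i (z (idx D i) - (gC (idx D i)).[midpoint (lo D i) (hi D i)])|.
  rewrite normr_prod -[d in m ^+ d]card_ord -prodr_const ler_prod // => i _.
  rewrite ltW //=; set x := (gC _).[_].
  have xg : `|x - (gC (idx D i)).[gamma i]| <= m.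
    have /(congr1 (horner^~ (gamma i))) := qE i; rewrite distrC !hornerE -/x.
    move=> ->; rewrite normrM (le_trans _ H1) // -mulrA ler_pM //.
      by rewrite (le_trans (qM i _ (gB i))).
    rewrite distrC; exact: dist_mid_gamma.
  have := Hdelta i _ (idx_gt1 D i); have := z1 (idx D i).
  move=> zk gk; rewrite distrC (le_trans _ (lerB_dist _ _)) //.
  rewrite lerBrDr (le_trans (lerD (lexx _) zk)) //.
  have gx : `|(gC (idx D i)).[gamma i]| <= m + `|x|.
    rewrite -[_.[gamma i]](subrK x) (le_trans (ler_normD _ _)) // lerD2r.
    by rewrite distrC.
  rewrite -(lerD2l m) (le_trans _ gx) // addrCA addrA -splitr addrC.
  by rewrite (le_trans _ gk) // addrC.
apply/eqP; rewrite eval_s_poly => /subr0_eq E.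
suff : m ^+ d <= m ^+ d / 2.
  by rewrite {1}[m ^+ d]splitr gerDl lt_geF // divr_gt0 // exprn_gt0.
apply: le_trans lower _; rewrite E normrM (le_trans _ H2) //.
rewrite -3!mulrA ler_pM //.
rewrite -/T -[d in d%:R]card_ord -[d in K ^+ d]card_ord mulrA.
apply: ler_dist_prod => //.
- by rewrite mulr_ge0.
- by move=> i; rewrite (le_trans (ler_normB _ _)) // ler_wpDr // lerD.
- by move=> i; rewrite (le_trans (ler_normB _ _)) // ler_wpDr // lerD.
move=> i; rewrite opprB addrC addrA subrK distrC.
exact: dist_mid_gamma.
Qed.

End Stability.

(** The root x is sent to a point of V(I), which is not in the polydisc. *)
Lemma univariate_point_large (R : realType) (n r : nat)
    (p : 'I_r -> {mpoly rat[n]}) (a : 'I_n -> rat) (f : {poly rat})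
    (g : 'I_n -> {poly rat}) (x : R[i]) :
  @zero_locus R n r p `&` @closed_polydisc R n = set0 ->
  @univariate_representation R n r p a f g ->
  pevalC f x = 0 -> exists k, 1 < `|pevalC (g k) x|.
Proof.
move=> disj [_ root_zero _ _] fx0; apply/existsP; apply: contraT.
rewrite negb_exists => /forallP small.
suff : set0 (gpoint g x) by [].
rewrite -disj; split=> [|k]; first exact: root_zero.
by have := small k; rewrite -real_leNgt ?normr_real.
Qed.

Theorem theorem7 (R : realType) (n r d : nat)
    (p : 'I_r -> {mpoly rat[n]})
    (a : 'I_n -> rat) (f : {poly rat}) (g : 'I_n -> {poly rat})
    (gamma : 'I_d -> R[i]) (wr : {mpoly rat[2]} -> iexpr)
    (wrK : forall h : {mpoly rat[2]}, iexpr_poly (wr h) = h)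
    (radI : radical_ideal p)
    (zerodimI : finite_set (@zero_locus R n r p))
    (disjI : @zero_locus R n r p `&` @closed_polydisc R n = set0)
    (repI : @univariate_representation R n r p a f g)
    (f_monic : f \is monic)
    (f_squarefree : squarefree_poly f)
    (gamma_inj : injective gamma)
    (f_factor : map_poly ratr f = \prod_(i < d) ('X - (gamma i)%:P)) :
  exists2 eps0 : R, 0 < eps0 &
    (forall eps : R, 0 < eps < eps0 ->
       inhabited (construction wr f g gamma eps) /\
       forall D : construction wr f g gamma eps,
         in_ideal (Ir_gen f g) (s_poly D)) /\
    (exists eps : R, 0 < eps < eps0 /\
       forall D : construction wr f g gamma eps,
         @stable R n (subst_t a (s_poly D))).
Proof.
have root_gamma i : pevalC f (gamma i) = 0.
  by apply/(pevalC_root f_factor); exists i.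
have large i := univariate_point_large disjI repI (root_gamma i).
exists 1 => //; split=> [eps /andP[eps0 _]|].
  split=> [|D]; last exact: s_poly_in_Ir.
  exact: construction_exists.
have [e0 e00 stab] := s_poly_stable g wrK f_factor a.
have m0 : 0 < Num.min e0 2^-1 by rewrite lt_min e00 invr_gt0 ltr0n.
exists (Num.min e0 2^-1); split; last by apply: stab; rewrite ?ge_min ?lexx.
by rewrite m0 gt_min invf_lt1 ?ltr1n ?orbT.
Qed.
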